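(* Let $G$ be an embedded graph, and for $A\subseteq E(G)$ let $G^{\delta(A)}$ be its partial dual with respect to $A$. (1) One has $$(-1)^{r(G)}\lambda^{c(G)}R(G;1-\lambda,-\lambda,1/\lambda)=\sum_{A\subseteq E(G)}(-1)^{|A|}\chi\big((G^{\delta(A)})^{\times};\lambda\big).$$ (2) If $G$ is a plane graph, then $$(-1)^{r(G)}(1-x)^{c(G)}T(G;x,x)=\sum_{A\subseteq E(G)}(-1)^{|A|}\chi\big((G^{\delta(A)})^{\times};1-x\big).$$
   Context: An embedded graph is a graph (loops and multiple edges allowed, not necessarily connected) cellularly embedded in a closed, possibly non-orientable, surface. Equivalently, it is a ribbon graph: a surface with boundary written as a union of vertex discs and edge discs (ribbons), each edge disc meeting the vertex discs in exactly two disjoint arcs. Equivalently, it is given by an arrow presentation: a set of circles carrying disjoint labelled arrows (marking arrows), exactly two with each label. The ribbon graph described by an arrow presentation has a vertex disc bounded by each circle, and for each label $e$ an edge disc with oriented boundary, attached along the two $e$-labelled arrows so that the directions of the arrows agree with the orientation of the boundary of the edge disc. Arrow presentations are considered up to describing the same ribbon graph. $c(G)$ is the number of connected components, $r(G)=|V(G)|-c(G)$, $n(G)=|E(G)|-r(G)$, and $f(G)$ is the number of boundary components of the ribbon graph. For $A\subseteq E(G)$, $c(A),r(A),n(A),f(A)$ refer to the spanning ribbon subgraph $(V(G),A)$. $G$ is plane if it is connected and has Euler genus $0$. Partial dual: $G^{\delta(A)}$ is obtained from an arrow presentation of $G$ by doing the following for each $e\in A$. If $\alpha,\beta$ are the two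 $e$-labelled arrows, draw a line segment carrying an arrow directed from the tip of $\alpha$ to the tail of $\beta$ and a line segment carrying an arrow directed from the tip of $\beta$ to the tail of $\alpha$; label both new arrows $e$; delete $\alpha$, $\beta$ and the arcs of circles on which they lie. (So $G^{\delta(E(G))}=G^*$ is the geometric dual.) The Petrie dual $G^{\times}$ is obtained by reversing exactly one of the two $e$-labelled arrows for every edge $e$ (i.e. adding a half-twist to every edge). Ribbon graph (Bollobás–Riordan) polynomial: $R(G;x,y,z)=\sum_{A\subseteq E(G)}(x-1)^{r(G)-r(A)}y^{n(A)}z^{c(A)-f(A)+n(A)}$. Tutte polynomial: $T(G;x,y)=\sum_{A\subseteq E(G)}(x-1)^{r(G)-r(A)}(y-1)^{n(A)}$. $\chi(H;\lambda)$ is the chromatic polynomial of the underlying abstract graph of $H$ (it is $0$ if $H$ has a loop). *)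

(* Defs.v *)
From HB Require Import structures.
From mathcomp Require Import all_boot all_order all_algebra.
Set Implicit Arguments.
Unset Strict Implicit.
Unset Printing Implicit Defensive.
Import Order.TTheory GRing.Theory Num.Theory.
Local Open Scope ring_scope.

Record multigraph := Multigraph {
  vert : finType;
  edge : finType;
  ends : edge -> vert * vert
}.

Section Multigraph.
Variable H : multigraph.
Implicit Types (A : {set edge H}) (k : nat).

Definition adj A : rel (vert H) := fun u v =>
  [exists e in A, (ends e == (u, v)) || (ends e == (v, u))].

Definition ncomp A : nat := n_comp (adj A) predT.

(* r(A), n(A) and all exponents below are integers, so that no truncated
   subtraction occurs. *)
Definition rk A : int := #|vert H|%:Z - (ncomp A)%:Z.
Definition nullity A : int := #|A|%:Z - rk A.

Definition proper_coloring k (f : {ffun vert H -> 'I_k}) : bool :=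
  [forall e : edge H, f (ends e).1 != f (ends e).2].

Definition nb_colorings k : nat := #|@proper_coloring k|.

Lemma adj_sym A : symmetric (adj A).
Proof. by move=> u v; apply: eq_existsb => e; rewrite orbC. Qed.

Lemma card_constant_colorings A k :
  #|[pred f : {ffun vert H -> 'I_k} |
      [forall e in A, f (ends e).1 == f (ends e).2]]| = (k ^ ncomp A)%N.
Proof.
have sA : connect_sym (adj A) by exact: sym_connect_sym (@adj_sym A).
pose S := {x : vert H | roots (adj A) x}.
pose ext (g : {ffun S -> 'I_k}) : {ffun vert H -> 'I_k} :=
  [ffun x => g (Sub (fingraph.root (adj A) x) (roots_root sA x))].
have ext_inj : injective ext.
  move=> g h /ffunP gh; apply/ffunP => -[x rx].
  have := gh x; rewrite !ffunE.
  have -> // : Sub (fingraph.root (adj A) x) (roots_root sA x) = exist _ x rx :> S.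
  by apply: val_inj => /=; apply/eqP.
have -> : (k ^ ncomp A)%N = #|{ffun S -> 'I_k}|.
  rewrite card_ffun card_ord card_sig; congr (_ ^ _)%N.
  by apply: eq_card => x; rewrite !inE andbT.
rewrite -(card_imset predT ext_inj); apply: eq_card => f; rewrite inE.
apply/idP/imsetP => [/forall_inP fA | [g _ ->]].
  have fc x y : connect (adj A) x y -> f x = f y.
    case/connectP => p; elim: p x => [|z p IHp] x /= => [_ -> //|].
    case/andP=> /exists_inP[e eA xz] pz py; rewrite -(IHp z pz py).
    by case/orP: xz (fA e eA) => /eqP-> /eqP /= ->.
  exists [ffun x : S => f (val x)] => //; apply/ffunP => x.
  by rewrite !ffunE /=; apply: fc; exact: connect_root.
apply/forall_inP => e eA; rewrite !ffunE; apply/eqP; congr (g _).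
apply: val_inj => /=; apply/eqP; rewrite root_connect //.
apply: connect1; apply/exists_inP; exists e => //.
by rewrite -surjective_pairing eqxx.
Qed.

Lemma whitney_expansion k :
  (\sum_(A : {set edge H}) (-1) ^+ #|A| * 'X^(ncomp A)).[k%:R]
    = (nb_colorings k)%:R :> int.
Proof.
rewrite horner_sum.
pose mono (f : {ffun vert H -> 'I_k}) e := f (ends e).1 == f (ends e).2.
transitivity (\sum_(A : {set edge H}) \sum_(f : {ffun vert H -> 'I_k})
    \prod_e (if e \in A then - (mono f e)%:R else 1) : int).
  apply: eq_bigr => A _.
  rewrite hornerM horner_exp hornerN hornerC hornerXn -natrX.
  rewrite -card_constant_colorings -[in X in _ * X]sum1_card natr_sum.
  rewrite big_distrr /=.
  rewrite big_mkcond; apply: eq_bigr => f _; rewrite inE -big_mkcond /=.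
  case: ifP => [/forall_inP fA | /negbT].
    rewrite mulr1 -prodr_const; apply: eq_bigr => e /fA fe.
    by rewrite /mono fe.
  rewrite negb_forall => /existsP[e]; rewrite negb_imply => /andP[eA /negPf fe].
  by rewrite (bigD1 e) //= /mono fe oppr0 mul0r.
rewrite exchange_big /= /nb_colorings -sum1_card natr_sum [RHS]big_mkcond /=.
apply: eq_bigr => f _.
have := @bigA_distr int 0 1 *%R +%R (edge H) (fun e => - (mono f e)%:R) (fun=> 1).
move=> /= distr; transitivity (\prod_(e : edge H) (- (mono f e)%:R + 1) : int).
  by rewrite distr; apply: eq_bigl => A; rewrite inE.
rewrite unfold_in; case: ifP => [/forallP fP | /negbT].
  by rewrite big1 // => e _; rewrite /mono (negPf (fP e)) oppr0 add0r.
rewrite negb_forall => /existsP[e]; rewrite negbK => fe.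
by rewrite (bigD1 e) //= /mono fe addNr mul0r.
Qed.

Lemma chromatic_poly_subproof :
  {p : {poly int} | forall k, p.[k%:R] = (nb_colorings k)%:R}.
Proof. by eexists; exact: whitney_expansion. Qed.

(* The polynomial whose value at every natural number k is the number of
   proper k-colourings; over int it is unique. *)
Definition chromatic_poly : {poly int} := sval chromatic_poly_subproof.

Definition chi (F : fieldType) (lam : F) : F :=
  (map_poly intr chromatic_poly).[lam].

End Multigraph.

(* (e, i, t) is an end of the i-th of the two e-labelled arrows: its tip if
   t = true, its tail if t = false. *)
Definition point (E : finType) : finType := (E * bool * bool)%type.

(* The circles of an arrow presentation are cut by the arrow ends into the
   arrows themselves and the unmarked arcs between them; [arc p] is the other
   end of the unmarked arc at p.  Circles that carry no arrow (isolated
   vertices) are only counted. *)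
Record arrow_presentation (E : finType) := ArrowPresentation {
  arc : point E -> point E;
  arcK : involutive arc;
  arc_neq : forall p, arc p != p;
  nb_bare : nat
}.

Section ArrowPresentation.
Variable E : finType.
Implicit Types (G : arrow_presentation E) (A : {set E}) (p : point E).

Definition curve (s1 s2 : point E -> point E) p : {set point E} :=
  [set q | connect [rel u v | (v == s1 u) || (v == s2 u)] p q].

Definition curves s1 s2 : {set {set point E}} :=
  [set curve s1 s2 p | p : point E].

Definition along_arrow p : point E :=
  let: (e, i, t) := p in (e, i, ~~ t).

(* Both arrows of e agree with an orientation of the boundary of the edge disc,
   so its two free sides join the tip of each arrow to the tail of the other. *)
Definition along_ribbon p : point E :=
  let: (e, i, t) := p in (e, ~~ i, ~~ t).

Definition circles G := curves (arc G) along_arrow.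

Fact curve_circles G p : curve (arc G) along_arrow p \in circles G.
Proof. exact: imset_f. Qed.

Definition vertex G : finType :=
  ({C : {set point E} | C \in circles G} + 'I_(nb_bare G))%type.

Definition vertex_at G p : vertex G :=
  inl (exist _ (curve (arc G) along_arrow p) (curve_circles G p)).

Definition underlying G : multigraph :=
  @Multigraph (vertex G) E
    (fun e => (vertex_at G (e, false, false), vertex_at G (e, true, false))).

Definition comps G A : nat := @ncomp (underlying G) A.
Definition rank G A : int := @rk (underlying G) A.
Definition null G A : int := @nullity (underlying G) A.

(* The boundary of (V(G), A) follows the sides of the ribbons in A, and passes
   straight along the arrows whose label is not in A. *)
Definition along_boundary A p : point E :=
  if p.1.1 \in A then along_ribbon p else along_arrow p.

Definition nb_boundary G A : nat :=
  (#|curves (arc G) (along_boundary A)| + nb_bare G)%N.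

Definition euler_genus G : int :=
  (2 * comps G setT)%:Z
  - (#|vertex G|%:Z - #|E|%:Z + (nb_boundary G setT)%:Z).

Definition plane G : Prop := comps G setT = 1%N /\ euler_genus G = 0.

Section Redraw.
Variables s s' : point E -> point E.
Hypotheses (sK : cancel s s') (s'K : cancel s' s).
Variable G : arrow_presentation E.

Let arc' p := s' (arc G (s p)).

Fact redraw_arcK : involutive arc'.
Proof. by move=> p; rewrite /arc' s'K arcK sK. Qed.

Fact redraw_arc_neq p : arc' p != p.
Proof. by rewrite -[X in _ != X]sK (can_eq s'K) arc_neq. Qed.

(* Same points, same unmarked arcs, new arrows: the end p of a new
   arrow is placed at the end s p of an old arrow. *)
Definition redraw : arrow_presentation E :=
  ArrowPresentation redraw_arcK redraw_arc_neq (nb_bare G).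
End Redraw.

(* For e in A the i-th new arrow goes from the tip of the i-th old arrow to the
   tail of the other old arrow. *)
Definition pdual_place A p : point E :=
  let: (e, i, t) := p in
  if e \in A then (if t then (e, ~~ i, false) else (e, i, true)) else p.

Definition pdual_unplace A p : point E :=
  let: (e, i, t) := p in
  if e \in A then (if t then (e, i, false) else (e, ~~ i, true)) else p.

Fact pdual_placeK A : cancel (pdual_place A) (pdual_unplace A).
Proof. by move=> [[e i] []] /=; case: ifP => eA /=; rewrite eA ?negbK. Qed.

Fact pdual_unplaceK A : cancel (pdual_unplace A) (pdual_place A).
Proof. by move=> [[e i] []] /=; case: ifP => eA /=; rewrite eA ?negbK. Qed.

Definition partial_dual G A : arrow_presentation E :=
  redraw (@pdual_placeK A) (@pdual_unplaceK A) G.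

(* Reverses the arrow i = true of every label. *)
Definition petrie_place p : point E :=
  let: (e, i, t) := p in (e, i, t (+) i).

Fact petrie_placeK : involutive petrie_place.
Proof. by move=> [[e i] t] /=; rewrite -addbA addbb addbF. Qed.

Definition petrie_dual G : arrow_presentation E :=
  redraw petrie_placeK petrie_placeK G.

Definition ribbon_poly G (F : fieldType) (x y z : F) : F :=
  \sum_(A : {set E})
    (x - 1) ^ (rank G setT - rank G A) * y ^ null G A
    * z ^ ((comps G A)%:Z - (nb_boundary G A)%:Z + null G A).

Definition tutte_poly G (F : fieldType) (x y : F) : F :=
  \sum_(A : {set E})
    (x - 1) ^ (rank G setT - rank G A) * (y - 1) ^ null G A.

End ArrowPresentation.

(* Main.v *)
Require Import Defs.
From HB Require Import structures.
From mathcomp Require Import all_boot all_order all_algebra zify ring.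
Set Implicit Arguments.
Unset Strict Implicit.
Unset Printing Implicit Defensive.
Import Order.TTheory GRing.Theory Num.Theory.
Local Open Scope ring_scope.

(* After cancelling exponents, the left-hand side of (1) is the sum over A of
   (-1)^|A| lam^f(A).  Both sides being polynomial in lam, it suffices to take
   lam = k.  Then k^f(A) counts the k-colourings of the arrow ends that are
   constant along the unmarked arcs and along the sides of the ribbons in A and
   of the arrows not in A.  The colourings of the partial dual satisfy the same
   conditions, plus properness at each edge (half-twists do not change the
   vertices).  Summing over A for a fixed colouring gives a product over the
   edges in which the excluded colourings cancel.
   For (2), f(A) = c(A) + n(A) when G is plane, because the Euler genus of
   (V(G), A) is monotone in A and vanishes for A empty and A = E(G). *)

(** * Components of finite relations and parity of involutions *)

Section Connectivity.
Variable T : finType.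
Implicit Types (e : rel T) (f : T -> T).

Lemma connect_const (X : eqType) e (h : T -> X) :
  (forall x y, e x y -> h x = h y) -> forall x y, connect e x y -> h x = h y.
Proof.
move=> he x y /(@closed_connect _ _ [pred z | h z == h x]) => /(_ _)/esym.
rewrite !inE eqxx => exy; apply/esym/eqP/exy => u v /he uv.
by rewrite !inE uv.
Qed.

Lemma n_comp_imset (X : finType) e (h : T -> X) :
  (forall x y, connect e x y = (h x == h y)) ->
  n_comp e predT = #|[set h x | x : T]|.
Proof.
move=> eh; have se : connect_sym e by move=> x y; rewrite !eh eq_sym.
have hroot x : h (fingraph.root e x) = h x.
  by apply/esym/eqP; rewrite -eh connect_root.
have -> : [set h x | x : T] = h @: [set x | roots e x].
  apply/setP=> z; apply/imsetP/imsetP => -[x _ ->]; last by exists x.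
  by exists (fingraph.root e x); rewrite ?inE ?roots_root ?hroot.
rewrite card_in_imset; last first.
  move=> x y; rewrite !inE => /eqP rx /eqP ry hxy.
  by rewrite -rx -ry; apply/eqP; rewrite root_connect // eh hxy.
by apply: eq_card => x; rewrite !inE andbT.
Qed.

(* e' generates the equivalence closure of e and the pair (u, v); the last
   hypothesis says so through the universal property. *)
Lemma n_comp_link e e' u v :
  connect_sym e -> connect_sym e' -> subrel e (connect e') ->
  connect e' u v ->
  (forall h : T -> T, (forall x y, e x y -> h x = h y) -> h u = h v ->
     forall x y, e' x y -> h x = h y) ->
  n_comp e predT = (n_comp e' predT + ~~ connect e u v)%N.
Proof.
move=> se se' ee' uv' univ; set r := fingraph.root e.
have rP x y : connect e x y = (r x == r y) by rewrite root_connect.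
have re x y : e x y -> r x = r y by move/connect1; rewrite rP => /eqP.
have sub : subrel (connect e) (connect e') := connect_sub ee'.
(* [h] labels the classes of [e']: the class of [v] is merged into that of [u], so at most the label
   [r v] is lost. *)
pose h x := if r x == r v then r u else r x.
have hE x y : connect e' x y = (h x == h y).
  apply/idP/eqP => [|hxy].
    apply: connect_const; apply: univ => [z t /re zt|]; first by rewrite /h zt.
    by rewrite /h eqxx; case: ifP.
  have xh z : connect e' z (h z).
    rewrite /h; case: ifP => [|_]; last by apply/sub/connect_root.
    rewrite -rP => /sub zv; apply: connect_trans zv _.
    rewrite se'; apply: connect_trans (uv'); rewrite se'.
    exact/sub/connect_root.
  by apply: connect_trans (xh x) _; rewrite hxy se'.
rewrite (n_comp_imset rP) (n_comp_imset hE) rP.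
have [ruv | ruv] := eqVneq (r u) (r v).
  rewrite addn0; congr #|pred_of_set _|; apply: eq_imset => x.
  by rewrite /h; case: eqP => // ->.
rewrite addnC (cardsD1 (r v)) imset_f //; congr (_ + #|pred_of_set _|)%N.
apply/setP => z; rewrite in_setD1.
apply/andP/imsetP => [[zv /imsetP[x _ zx]]|[x _ ->]].
  by exists x; rewrite // /h -zx (negPf zv).
by rewrite /h; case: ifP => [_|/negbT xv]; split=> //; exact: imset_f.
Qed.

(** Orbits [{x, f x}] have exactly two elements; they are removed one at a time. *)
Lemma even_card_involutive f (A : {set T}) :
  involutive f -> (forall x, f x != x) -> {in A, forall x, f x \in A} ->
  ~~ odd #|A|.
Proof.
move=> fK f_neq; elim: {A}_.+1 {-2}A (ltnSn #|A|) => // n IHn A ltAn fA.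
have [-> | [x xA]] := set_0Vmem A; first by rewrite cards0.
have fxA : f x \in A :\ x by rewrite !inE f_neq fA.
move: ltAn; rewrite (cardsD1 x) xA (cardsD1 (f x)) fxA /= negbK => ltAn.
apply: IHn => [|y]; first by rewrite !add1n ltnS in ltAn; exact: ltnW.
rewrite !inE => /and3P[yfx yx yA]; rewrite fA // andbT.
by rewrite (can_eq fK) yx (can2_eq fK fK) yfx.
Qed.

End Connectivity.

(** * Curves traced by two involutions, and their colourings *)

Section Curves.
Variables (E : finType) (s1 s2 : point E -> point E).
Hypotheses (s1K : involutive s1) (s2K : involutive s2).

Definition steps : rel (point E) := [rel u v | (v == s1 u) || (v == s2 u)].

Lemma steps_sym : connect_sym steps.
Proof.
apply: sym_connect_sym => u v; rewrite /steps /=.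
by rewrite ![v == _]eq_sym (can2_eq s1K s1K) (can2_eq s2K s2K).
Qed.

Lemma curve_eq p q : (curve s1 s2 p == curve s1 s2 q) = connect steps p q.
Proof.
apply/eqP/idP => [pq | pq].
  by rewrite steps_sym; have := connect0 steps p; have /setP/(_ p) := pq;
    rewrite !inE => ->.
by apply/setP => x; rewrite !inE; apply: same_connect pq _; exact: steps_sym.
Qed.

Lemma card_curves : #|curves s1 s2| = n_comp steps predT.
Proof. by apply/esym/n_comp_imset => p q; rewrite curve_eq. Qed.

Definition const_on k (f : {ffun point E -> 'I_k}) : bool :=
  [forall p, (f (s1 p) == f p) && (f (s2 p) == f p)].

Fact curve_in p : curve s1 s2 p \in curves s1 s2.
Proof. exact: imset_f. Qed.

Definition curve_at p : {C | C \in curves s1 s2} :=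
  Sub (curve s1 s2 p) (curve_in p).

(** Colourings of the curves pull back to colourings of points constant along both involutions, and
    descend through representatives; the [b] bare circles are coloured freely. [Q] leaves room for
    properness. *)
Lemma card_curve_colorings k b (Q : pred {ffun point E -> 'I_k}) :
  #|[pred g : {ffun {C | C \in curves s1 s2} + 'I_b -> 'I_k} |
      Q [ffun p => g (inl (curve_at p))]]|
  = (#|[pred f | const_on f && Q f]| * k ^ b)%N.
Proof.
have clsP (C : {C | C \in curves s1 s2}) : exists p, curve s1 s2 p == val C.
  by case: C => C /= /imsetP[p _ ->]; exists p.
pose rep C := xchoose (clsP C).
have repK C : curve_at (rep C) = C.
  by apply/val_inj/eqP; exact: xchooseP (clsP C).
pose Phi (g : {ffun {C | C \in curves s1 s2} + 'I_b -> 'I_k}) :=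
  ([ffun p => g (inl (curve_at p))], [ffun i => g (inr i)]).
have Phi_inj : injective Phi.
  move=> g h gh; have /ffunP ghl := congr1 fst gh.
  have /ffunP ghr := congr1 snd gh; apply/ffunP => -[C | i].
    by have := ghl (rep C); rewrite !ffunE repK.
  by have := ghr i; rewrite !ffunE.
have -> : (k ^ b)%N = #|{ffun 'I_b -> 'I_k}| by rewrite card_ffun !card_ord.
rewrite -(card_imset _ Phi_inj) -cardX; apply: eq_card => -[f h].
rewrite !inE /= andbT; apply/imsetP/andP => [[g Qg fh] | [/forallP fc Qf]].
  have {fh}-> : f = (Phi g).1 by rewrite -fh.
  split=> //; apply/forallP => p; rewrite !ffunE.
  suff cls_step q : steps p q -> curve_at q = curve_at p.
    by rewrite (cls_step (s1 p)) ?(cls_step (s2 p)) ?eqxx // /steps /= eqxx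
      ?orbT.
  by move=> pq; apply/val_inj/eqP; rewrite curve_eq steps_sym connect1.
have f_curve_at p : f (rep (curve_at p)) = f p.
  apply: (@connect_const _ _ steps) => [x y|]; last first.
    by rewrite -curve_eq; apply/eqP; have [] := repK (curve_at p).
  by have /andP[/eqP f1 /eqP f2] := fc x; case/orP=> /eqP->.
pose g : {ffun {C | C \in curves s1 s2} + 'I_b -> 'I_k} :=
  [ffun v => match v with inl C => f (rep C) | inr i => h i end].
have gf : Phi g = (f, h).
  by congr pair; apply/ffunP => x; rewrite !ffunE ?f_cls.
exists g => //; rewrite inE; case: gf => gf _.
by move: Qf; rewrite -{1}gf.
Qed.

Lemma card_const_on k b :
  (k ^ (#|curves s1 s2| + b))%N
  = (#|[pred f : {ffun point E -> 'I_k} | const_on f]| * k ^ b)%N.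
Proof.
transitivity #|{ffun {C | C \in curves s1 s2} + 'I_b -> 'I_k}|.
  by rewrite card_ffun card_sum card_sig !card_ord.
rewrite (@card_curve_colorings _ _ predT); congr (_ * _)%N.
by apply: eq_card => f; rewrite !inE andbT.
Qed.
End Curves.

(** * Colouring counts and their signed sums over edge sets *)

Section Colorings.
Variables (E : finType) (G : arrow_presentation E).
Implicit Types (A : {set E}) (e : E) (p : point E).

Lemma along_arrowK : involutive (@along_arrow E).
Proof. by move=> [[e i] t] /=; rewrite negbK. Qed.

Lemma along_boundary_label A p : (along_boundary A p).1.1 = p.1.1.
Proof. by case: p => [[e i] t]; rewrite /along_boundary; case: ifP. Qed.

Lemma along_boundaryK A : involutive (along_boundary A).
Proof.
move=> [[e i] t]; rewrite /along_boundary /=.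
by case eA: (e \in A); rewrite /= eA !negbK.
Qed.

Lemma along_boundary_neq A p : along_boundary A p != p.
Proof.
case: p => [[e i] t]; rewrite /along_boundary.
have tN : (~~ t == t) = false by case: t.
by case: ifP => _ /=; rewrite !xpair_eqE tN andbF.
Qed.

Section Local.
Variable k : nat.
Implicit Types f : {ffun point E -> 'I_k}.

(* With b = false the two sides are the two e-labelled arrows, with b = true
   they are the two free sides of the ribbon e. *)
Definition sides_const (b : bool) f e : bool :=
  (f (e, false, false) == f (e, b, true))
  && (f (e, true, false) == f (e, ~~ b, true)).

Definition arc_const f : bool := [forall p, f (Defs.arc G p) == f p].

(** Isolates the dependence on [A] in one condition per edge, so that a signed sum over [A] can
    factor over the edges. *)
Lemma const_on_boundary A f :
  const_on (Defs.arc G) (along_boundary A) f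
  = arc_const f && [forall e, sides_const (e \in A) f e].
Proof.
apply/forallP/andP => [fc | [/forallP fa /forallP fs] p].
  split; apply/forallP => x; first by have /andP[] := fc x.
  have /andP[_] := fc (x, false, false); have /andP[_] := fc (x, true, false).
  rewrite /along_boundary /sides_const /=; case: ifP => _ /=;
  by rewrite ![_ == f (_, _, true)]eq_sym => -> ->.
rewrite fa /=; case: p => [[e i] t]; have := fs e.
rewrite /along_boundary /sides_const /=; case: ifP => _;
by case/andP=> /eqP e1 /eqP e2; case: i t => [] []; rewrite /= ?e1 ?e2.
Qed.

Lemma nb_boundary_count A :
  (k ^ nb_boundary G A)%N
  = (#|[pred f | arc_const f && [forall e, sides_const (e \in A) f e]]|
     * k ^ nb_bare G)%N.
Proof.
rewrite /nb_boundary card_const_on //; [|exact: arcK|exact: along_boundaryK].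
by congr (_ * _)%N; apply: eq_card => f; rewrite !inE const_on_boundary.
Qed.

Lemma nb_colorings_count A :
  nb_colorings (underlying (petrie_dual (partial_dual G A))) k
  = (#|[pred f | arc_const f &&
         [forall e, sides_const (e \in A) f e
                    && ~~ sides_const (e \notin A) f e]]|
     * k ^ nb_bare G)%N.
Proof.
set H := petrie_dual _.
pose Q f := [forall e, f (e, false, false) != f (e, true, false)].
have vE p : vertex_at H p = inl (curve_at (Defs.arc H) (@along_arrow E) p).
  by congr inl; exact: val_inj.
transitivity #|[pred g : {ffun vertex H -> 'I_k} |
    Q [ffun p => g (inl (curve_at (Defs.arc H) (@along_arrow E) p))]]|.
  apply: eq_card => g; rewrite !inE.
  by apply: eq_forallb => e; rewrite !ffunE -!vE.
rewrite [LHS](card_curve_colorings (@arcK _ H) along_arrowK (nb_bare G) Q).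
congr (_ * _)%N.
(* [s] sends an end of a new arrow to the old end where it is placed; [tr] transports colourings
   along it. *)
pose s p := pdual_place A (petrie_place p).
pose s' p := petrie_place (pdual_unplace A p).
have sK : cancel s s'.
  by move=> p; rewrite /s /s' pdual_placeK petrie_placeK.
have s'K : cancel s' s.
  by move=> p; rewrite /s /s' petrie_placeK pdual_unplaceK.
pose tr (f : {ffun point E -> 'I_k}) := [ffun p => f (s p)].
have tr_inj : injective tr.
  move=> f g /ffunP fg; apply/ffunP => p.
  by have := fg (s' p); rewrite !ffunE s'K.
rewrite -[RHS](card_imset _ tr_inj); apply: eq_card => g.
have [f ->] : exists f, g = tr f.
  by exists [ffun p => g (s' p)]; apply/ffunP => p; rewrite !ffunE sK.
rewrite mem_imset // !inE.
have -> : const_on (Defs.arc H) (@along_arrow E) (tr f)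
  = arc_const f && [forall e, sides_const (e \in A) f e].
  apply/forallP/andP => [fc | [/forallP fa /forallP fs] p].
    split; apply/forallP => x.
      have /andP[] := fc (s' x).
      by rewrite !ffunE /= -/(s' _) -/(s _) -/(s' _) !s'K.
    have /andP[_] := fc (x, false, false); have /andP[_] := fc (x, true, false).
    rewrite !ffunE /s /sides_const /=; case: ifP => _ /=.
      by move/eqP=> -> /eqP ->; rewrite !eqxx.
    by move/eqP=> -> /eqP ->; rewrite !eqxx.
  rewrite !ffunE /= -/(s' _) s'K fa; case: p => [[e i] t]; have := fs e.
  rewrite /s /sides_const /=; case: ifP => _ /andP[/eqP f1 /eqP f2];
  by case: i t => [] []; rewrite /= ?f1 ?f2.
(* When both sides of one kind are monochromatic, each side of the other kind joins an end of the
   first to an end of the second, so it is monochromatic exactly when the two colours agree. *)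
have key e : sides_const (e \in A) f e ->
    (tr f (e, false, false) != tr f (e, true, false))
    = ~~ sides_const (e \notin A) f e.
  rewrite !ffunE /s /sides_const /=; case: ifP => _ /andP[/eqP -> /eqP ->] /=;
  by rewrite [in RHS]eq_sym andbb // eq_sym.
rewrite -andbA; congr (_ && _).
apply/andP/forallP => [[/forallP fs /forallP fQ] e | fs].
  by rewrite -key fs //; exact: fQ.
by split; apply/forallP => e; have /andP[fe] := fs e; rewrite ?key.
Qed.

End Local.


(** Distributivity: in the expanded product, [A] collects the edges where the negative term is
    chosen. *)
Lemma signed_count (X : finType) (P : pred X) (w : bool -> X -> pred E) :
  \sum_(A : {set E}) (-1) ^+ #|A|
      * #|[pred f | P f && [forall e, w (e \in A) f e]]|%:R
  = \sum_(f | P f) \prod_e (- (w true f e)%:R + (w false f e)%:R) :> int.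
Proof.
transitivity (\sum_(A : {set E}) \sum_(f | P f)
    \prod_e (if e \in A then - (w true f e)%:R else (w false f e)%:R) : int).
  apply: eq_bigr => A _; rewrite -[in X in _ * X]sum1_card natr_sum.
  rewrite big_distrr /= [LHS]big_mkcond [RHS]big_mkcond.
  apply: eq_bigr => f _; rewrite !inE.
  case: (P f) => //=; case: ifP => [/forallP fA | /negbT].
    rewrite mulr1 -prodr_const big_mkcond /=; apply: eq_bigr => e _.
    by case: ifP (fA e) => _ ->.
  rewrite negb_forall => /existsP[e /negPf fe].
  by rewrite (bigD1 e) //=; case: ifP fe => _ ->; rewrite ?oppr0 mul0r.
rewrite exchange_big; apply: eq_bigr => f _.
have /= -> := @bigA_distr int 0 1 *%R +%R E (fun e => - (w true f e)%:R)
  (fun e => (w false f e)%:R).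
by apply: eq_bigl => A; rewrite inE.
Qed.

(* The colourings constant on all four ends of an arrow enter with opposite
   signs, so imposing properness does not change the sum. *)
Lemma signed_nb_colorings k :
  \sum_(A : {set E}) (-1) ^+ #|A| * (k ^ nb_boundary G A)%:R
  = \sum_(A : {set E}) (-1) ^+ #|A|
      * (nb_colorings (underlying (petrie_dual (partial_dual G A))) k)%:R
  :> int.
Proof.
pose w b (f : {ffun point E -> 'I_k}) e :=
  sides_const b f e && ~~ sides_const (~~ b) f e.
transitivity (\sum_(f : {ffun point E -> 'I_k} | arc_const f)
  \prod_e (- (sides_const true f e)%:R + (sides_const false f e)%:R)
  * (k ^ nb_bare G)%:R : int).
  rewrite -big_distrl -signed_count big_distrl /=; apply: eq_bigr => A _.
  by rewrite nb_boundary_count natrM mulrA.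
transitivity (\sum_(f : {ffun point E -> 'I_k} | arc_const f)
  \prod_e (- (w true f e)%:R + (w false f e)%:R) * (k ^ nb_bare G)%:R : int).
  apply: eq_bigr => f _; congr (_ * _); apply: eq_bigr => e _.
  by rewrite /w; case: sides_const => //; case: sides_const.
rewrite -big_distrl -signed_count big_distrl /=; apply: eq_bigr => A _.
by rewrite nb_colorings_count natrM mulrA.
Qed.

Lemma poly_int_eq (p q : {poly int}) :
  (forall k : nat, p.[k%:R] = q.[k%:R]) -> p = q.
Proof.
move=> pq; apply/eqP; rewrite -subr_eq0; apply: contraT => nz.
(* A nonzero polynomial has fewer roots than its size, so [size (p - q)] distinct naturals are one
   too many. *)
have := @max_poly_roots _ _ [seq k%:R | k <- iota 0 (size (p - q))] nz.
rewrite size_map size_iota ltnn => -> //.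
  by apply/allP => _ /mapP[k _ ->]; rewrite rootE hornerD hornerN pq subrr.
rewrite map_inj_uniq ?iota_uniq // => m n /eqP.
by rewrite eqr_nat => /eqP.
Qed.

(** The identity is first proved in [{poly int}], where values at naturals determine a polynomial,
    and then mapped to [F], which may be finite. *)
Lemma signed_chromatic (F : fieldType) (lam : F) :
  \sum_(A : {set E}) (-1) ^+ #|A| * lam ^+ nb_boundary G A
  = \sum_(A : {set E})
      (-1) ^+ #|A| * chi (underlying (petrie_dual (partial_dual G A))) lam.
Proof.
pose p : {poly int} := \sum_(A : {set E}) (-1) ^+ #|A| * 'X^(nb_boundary G A).
pose q : {poly int} := \sum_(A : {set E}) (-1) ^+ #|A|
  * chromatic_poly (underlying (petrie_dual (partial_dual G A))).
have evalE (r : {set E} -> {poly int}) :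
    (map_poly intr (\sum_(A : {set E}) (-1) ^+ #|A| * r A)).[lam]
    = \sum_(A : {set E}) (-1) ^+ #|A| * (map_poly intr (r A)).[lam] :> F.
  rewrite rmorph_sum horner_sum; apply: eq_bigr => A _.
  by rewrite rmorphM rmorphXn rmorphN rmorph1 hornerM horner_exp hornerN
    hornerC.
have : p = q.
  apply: poly_int_eq => k; rewrite !horner_sum.
  transitivity (\sum_(A : {set E})
    (-1) ^+ #|A| * (k ^ nb_boundary G A)%:R : int).
    apply: eq_bigr => A _.
    by rewrite hornerM horner_exp hornerN hornerC hornerXn natrX.
  rewrite signed_nb_colorings; apply: eq_bigr => A _.
  by rewrite hornerM horner_exp hornerN hornerC
    (svalP (chromatic_poly_subproof _)).
move/(congr1 (fun r => (map_poly intr r).[lam])); rewrite !evalE => pq.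
rewrite -[RHS]pq; apply: eq_bigr => A _.
by rewrite map_polyXn hornerXn.
Qed.

End Colorings.

(** * Euler genus of spanning ribbon subgraphs *)

Section Genus.
Variables (E : finType) (G : arrow_presentation E).
Implicit Types (A B : {set E}) (e : E) (p : point E).

Notation boundary_steps A := (steps (Defs.arc G) (along_boundary A)).

Lemma boundary_steps_sym A : connect_sym (boundary_steps A).
Proof. by apply: steps_sym; [exact: arcK | exact: along_boundaryK]. Qed.

Lemma arc_step A p : connect (boundary_steps A) p (Defs.arc G p).
Proof. by apply: connect1; rewrite /steps /= eqxx. Qed.

Lemma boundary_step A p : connect (boundary_steps A) p (along_boundary A p).
Proof. by apply: connect1; rewrite /steps /= eqxx orbT. Qed.

(* Identifies the four ends of the arrows labelled e, so that the result does
   not depend on whether e is in A. *)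
Definition pinched_steps A e : rel (point E) :=
  [rel p q | boundary_steps A p q || (p.1.1 == e) && (q.1.1 == e)].

(** Adding [e] alters only boundary steps between ends labelled [e], which the pinching absorbs. *)
Lemma pinched_stepsU1 A e : pinched_steps (e |: A) e =2 pinched_steps A e.
Proof.
move=> p q; rewrite /pinched_steps /steps /=.
have [pe | pe] := eqVneq p.1.1 e; last first.
  by rewrite /along_boundary in_setU1 (negPf pe).
have [// | qe] := eqVneq q.1.1 e; first by rewrite !orbT.
have neq B : (q == along_boundary B p) = false.
  by apply: contraNF qe => /eqP->; rewrite along_boundary_label pe.
by rewrite !neq.
Qed.

Lemma pinched_steps_sym A e : connect_sym (pinched_steps A e).
Proof.
apply: sym_connect_sym => p q; rewrite /pinched_steps /steps /=.
rewrite [(q.1.1 == e) && _]andbC ![q == _]eq_sym.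
rewrite (can2_eq (@arcK _ G) (@arcK _ G)).
by rewrite (can2_eq (@along_boundaryK _ A) (@along_boundaryK _ A)).
Qed.

(** Whether or not [e] is in [A], boundary steps pair each tail of [e] with a tip, so pinching
    amounts to linking the two tails. *)
Lemma boundary_curves_link A e :
  #|curves (Defs.arc G) (along_boundary A)|
  = (n_comp (pinched_steps A e) predT
     + ~~ connect (boundary_steps A) (e, false, false) (e, true, false))%N.
Proof.
rewrite card_curves; [|exact: arcK|exact: along_boundaryK].
apply: n_comp_link.
- exact: boundary_steps_sym.
- exact: pinched_steps_sym.
- by move=> p q pq; apply: connect1; rewrite /pinched_steps /= pq.
- by apply: connect1; rewrite /pinched_steps /= eqxx orbT.
move=> h hA huv p q /orP[/hA // | /andP[]].
have ends_const i t : h (e, i, t) = h (e, false, false).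
  case: t; last by case: i.
  have := hA (e, i, true) (along_boundary A (e, i, true)) _.
  rewrite /steps /= eqxx orbT => ->//.
  by rewrite /along_boundary /=; case: ifP => _; case: i.
case: p q => [[e1 i] t] [[e2 j] u] /= /eqP-> /eqP->.
by rewrite !ends_const.
Qed.

Lemma comps_link A e :
  comps G A = (comps G (e |: A) + ~~ connect (adj (H := underlying G) A)
    (vertex_at G (e, false, false)) (vertex_at G (e, true, false)))%N.
Proof.
have adj_connect_sym B : connect_sym (adj (H := underlying G) B).
  apply: sym_connect_sym; exact: adj_sym.
apply: n_comp_link => //.
- move=> x y /exists_inP[d dA xy]; apply: connect1; apply/exists_inP.
  by exists d; rewrite // in_setU1 dA orbT.
- by apply: connect1; apply/exists_inP; exists e; rewrite ?setU11 ?eqxx.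
move=> h hA huv x y /exists_inP[d]; rewrite in_setU1 => /orP[/eqP->|dA xy].
  by case/orP=> /eqP[<- <-].
by apply: hA; apply/exists_inP; exists d.
Qed.

Lemma vertex_at_step p q :
  steps (Defs.arc G) (@along_arrow E) p q -> vertex_at G p = vertex_at G q.
Proof.
move=> pq; congr inl; apply/val_inj/eqP => /=.
by rewrite curve_eq ?connect1 //; [exact: arcK | exact: along_arrowK].
Qed.

Lemma vertex_at_tail e i t : vertex_at G (e, i, t) = vertex_at G (e, i, false).
Proof.
by case: t => //; apply: vertex_at_step; rewrite /steps /= eqxx orbT.
Qed.

(** A step stays on its vertex circle or follows a ribbon in [A]. *)
Lemma boundary_in_comp A p q :
  connect (boundary_steps A) p q ->
  connect (adj (H := underlying G) A) (vertex_at G p) (vertex_at G q).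
Proof.
have sA : connect_sym (adj (H := underlying G) A).
  apply: sym_connect_sym; exact: adj_sym.
move=> pq; rewrite -(root_connect sA); apply/eqP; move: p q pq.
apply: connect_const => p q pq; apply/eqP.
rewrite (root_connect sA).
case/orP: pq => /eqP->.
  rewrite (@vertex_at_step p (Defs.arc G p)) ?connect0 //.
  by rewrite /steps /= eqxx.
case: p => [[e i] t]; rewrite /along_boundary /=.
case: ifP => eA; rewrite vertex_at_tail [X in connect _ _ X]vertex_at_tail //.
apply: connect1; apply/exists_inP; exists e => //=.
by case: i; rewrite eqxx ?orbT.
Qed.

(* A boundary walk leaving the tail of one e-labelled arrow has to come back to
   another end of an e-labelled arrow (parity); if e is a bridge, only the tip
   of the same arrow is available. *)
Lemma bridge_boundary A e :
  e \notin A ->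
  ~~ connect (adj (H := underlying G) A)
       (vertex_at G (e, false, false)) (vertex_at G (e, true, false)) ->
  connect (boundary_steps (e |: A)) (e, false, false) (e, true, false).
Proof.
move=> eA bridge; set a := (e, false, false).
(* Walks that stop at ends labelled [e]; they are boundary walks for both [A] and [e |: A]. *)
pose P : rel (point E) := [rel p q | (q == Defs.arc G p)
  || (p.1.1 != e) && (q == along_boundary A p)].
have sub B : B :\ e = A :\ e -> subrel (connect P) (connect (boundary_steps B)).
  move=> /setP BA; apply: connect_sub => p q /orP[/eqP-> | /andP[pe /eqP->]].
    exact: arc_step.
  have := BA p.1.1; rewrite !inE pe /= => pB.
  by have := boundary_step B p; rewrite /along_boundary pB.
have /sub subA : A :\ e = A :\ e by [].
have /sub subU : (e |: A) :\ e = A :\ e.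
  by apply/setP=> d; rewrite !inE; case: eqP.
pose S := [set p | connect P a p].
have [/subU // | cS] := boolP (connect P a (e, true, false)).
have [/subU ab | bS] := boolP (connect P a (e, false, true)).
  apply: connect_trans ab _; have := boundary_step (e |: A) (e, false, true).
  by rewrite /along_boundary /= setU11.
have dS : ~~ connect P a (e, true, true).
  apply: contra bridge => /subA/boundary_in_comp.
  by rewrite (vertex_at_tail e true true).
have Se p : p \in S -> p.1.1 = e -> p = a.
  case: p => [[e' i] t]; rewrite inE => + /= pe; rewrite pe.
  by case: i t => [] []; rewrite ?(negPf bS) ?(negPf cS) ?(negPf dS).
(* With [a] the only end of [e] in [S], unmarked arcs pair up [S] while boundary steps pair up
   [S :\ a]: a contradiction. *)
have evenS : ~~ odd #|S|.
  apply: (@even_card_involutive _ (Defs.arc G)) => [||p]; first exact: arcK.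
    exact: arc_neq.
  rewrite !inE => ap; apply: connect_trans ap (connect1 _).
  by rewrite /P /= eqxx.
have evenSa : ~~ odd #|S :\ a|.
  apply: (@even_card_involutive _ (along_boundary A)) => [||p].
  - exact: along_boundaryK.
  - exact: along_boundary_neq.
  rewrite in_setD1 => /andP[pa pS].
  have pe : p.1.1 != e by apply: contra pa => /eqP/(Se _ pS)->.
  rewrite in_setD1; apply/andP; split.
    by apply: contraNneq pe => pa'; rewrite -(along_boundary_label A) pa'.
  move: pS; rewrite !inE => ap; apply: connect_trans ap (connect1 _).
  by rewrite /P /= pe eqxx orbT.
by move: evenS; rewrite (cardsD1 a) inE connect0 oddD (negPf evenSa).
Qed.

Definition genus_of A : int :=
  (2 * comps G A)%:Z - (#|vertex G|%:Z - #|A|%:Z + (nb_boundary G A)%:Z).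

(** The change is 1 + 2(change of c) - (change of f). If c is fixed, f grows by at most 1; if c
    drops by 1, two boundary curves merge and the change is 0. *)
Lemma genus_ofU1 A e : e \notin A -> genus_of A <= genus_of (e |: A).
Proof.
move=> eA; have := bridge_boundary eA.
have := @boundary_in_comp A (e, false, false) (e, true, false).
rewrite /genus_of /nb_boundary (comps_link A e) (boundary_curves_link A e).
rewrite (boundary_curves_link (e |: A) e) cardsU1 eA.
have -> : n_comp (pinched_steps (e |: A) e) predT
          = n_comp (pinched_steps A e) predT.
  exact/eq_n_comp/eq_connect/pinched_stepsU1.
case: connect; case: connect; case: connect => /=; lia.
Qed.

Lemma genus_of_subset A B : A \subset B -> genus_of A <= genus_of B.
Proof.
elim: {A}#|_| {-2}A (erefl #|B :\: A|) => [|n IHn] A cBA sAB.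
  have BA : B \subset A by rewrite -setD_eq0 -cards_eq0 cBA.
  by have -> : A = B by apply/eqP; rewrite eqEsubset sAB.
have [e] : exists e, e \in B :\: A by apply/card_gt0P; rewrite cBA.
rewrite inE => /andP[eA eB]; apply: le_trans (genus_ofU1 eA) _.
apply: IHn; last by rewrite subUset sub1set eB.
move: cBA; rewrite (cardsD1 e) inE eA eB => -[<-].
by apply: eq_card => x; rewrite !inE negb_or andbA.
Qed.

Lemma genus_of0 : genus_of set0 = 0.
Proof.
rewrite /genus_of; have -> : comps G set0 = #|vertex G|.
  rewrite /comps /ncomp (@n_comp_imset _ _ _ id) => [|x y].
    by rewrite card_imset.
  apply/idP/eqP => [|->]; last exact: connect0.
  by apply: (@connect_const _ _ _ id) => u v /exists_inP[d]; rewrite inE.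
have -> : nb_boundary G set0 = #|vertex G|.
  rewrite card_sum card_sig card_ord /nb_boundary; congr (_ + _)%N.
  rewrite /circles !card_curves; try exact: arcK; try exact: along_arrowK;
    try exact: along_boundaryK.
  apply: eq_n_comp; apply: eq_connect => p q.
  by rewrite /steps /along_boundary /= inE.
rewrite cards0; lia.
Qed.

(** Monotonicity squeezes the genus of (V(G), A) between 0 and 0; Euler's formula is then solved for
    f(A). *)
Lemma plane_boundary A :
  plane G -> (nb_boundary G A)%:Z = (comps G A)%:Z + null G A.
Proof.
case=> _ gT; have gTE : genus_of setT = 0 by rewrite -gT /genus_of cardsT.
have := genus_of_subset (subsetT A); have := genus_of_subset (sub0set A).
rewrite genus_of0 gTE /genus_of /null /nullity /rk /comps /=.
rewrite -/(comps G A); lia.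
Qed.

(** Connectedness supplies a vertex: its circle carries an arrow end, hence meets a boundary curve,
    or is bare and counted itself. *)
Lemma nb_boundary_gt0 A : plane G -> (0 < nb_boundary G A)%N.
Proof.
case=> c1 _; have : (0 < comps G setT)%N by rewrite c1.
case/card_gt0P => -[[C CG] | i] _; rewrite addn_gt0; apply/orP; [left | right].
  case/imsetP: CG => p _ _; apply/card_gt0P.
  by exists (curve (Defs.arc G) (along_boundary A) p); exact: curve_in.
exact: leq_ltn_trans (ltn_ord i).
Qed.

End Genus.

(** * Specialising the polynomials, and the two identities *)

Lemma ribbon_poly_boundary (E : finType) (G : arrow_presentation E)
    (F : fieldType) (lam : F) :
  lam != 0 ->
  (-1) ^ rank G setT * lam ^+ comps G setT
    * ribbon_poly G (1 - lam) (- lam) (1 / lam)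
  = \sum_(A : {set E}) (-1) ^+ #|A| * lam ^+ nb_boundary G A.
Proof.
move=> lam0; rewrite big_distrr; apply: eq_bigr => A _ /=.
have m0 : -1 != 0 :> F by rewrite oppr_eq0 oner_eq0.
have -> : 1 - lam - 1 = -1 * lam by ring.
have -> : - lam = -1 * lam by ring.
rewrite div1r exprz_inv !expfzMl exprnP.
set r := rank G setT - rank G A; set n := null G A; set d := _ + n.
(* All factors are gathered into one power of -1, with exponent |A| + 2r, and one of [lam], where
   the c and n terms cancel down to f(A). *)
transitivity
  ((-1) ^ (rank G setT + r + n) * lam ^ ((comps G setT)%:Z + r + n - d)).
  rewrite (expfzDr _ n m0) (expfzDr _ r m0).
  rewrite (expfzDr _ (- d) lam0) (expfzDr _ n lam0) (expfzDr _ r lam0).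
  move: (_ ^ rank G setT) (_ ^ r) (_ ^ n).
  move: (lam ^ _) (lam ^ r) (lam ^ n) (lam ^ _).
  by move=> *; ring.
congr (_ * _).
  have -> : rank G setT + r + n = #|A|%:Z + 2%:Z * r.
    rewrite /r /n; have -> : null G A = #|A|%:Z - rank G A := erefl.
    by move: (rank G A) (rank G setT) (#|A|%:Z) => *; ring.
  by rewrite expfzDr // -exprz_exp -!exprnP sqrrN expr1n exp1rz mulr1.
have -> : r = (comps G A)%:Z - (comps G setT)%:Z.
  rewrite /r; have rankE B : rank G B = #|vertex G|%:Z - (comps G B)%:Z by [].
  by rewrite (rankE setT) (rankE A) opprB addrC addrA subrK.
have dE (a b c m : int) : a + (b - a) + m - (b - c + m) = c by ring.
by rewrite /d dE exprnP.
Qed.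

Theorem corollary5p5 (E : finType) (G : arrow_presentation E) :
  (forall (F : fieldType) (lam : F), lam != 0 ->
     (-1) ^ rank G setT * lam ^+ comps G setT
       * ribbon_poly G (1 - lam) (- lam) (1 / lam)
     = \sum_(A : {set E})
         (-1) ^+ #|A| * chi (underlying (petrie_dual (partial_dual G A))) lam)
  /\
  (plane G ->
   forall (F : fieldType) (x : F),
     (-1) ^ rank G setT * (1 - x) ^+ comps G setT * tutte_poly G x x
     = \sum_(A : {set E})
         (-1) ^+ #|A|
         * chi (underlying (petrie_dual (partial_dual G A))) (1 - x)).
Proof.
split=> [F lam lam0 | plG F x].
  by rewrite -signed_chromatic ribbon_poly_boundary.
(* The case [x = 1] is separate because the first identity inverts [lam]; here both sides vanish, as
   c(G) = 1 and every f(A) is positive. *)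
rewrite -signed_chromatic; have [x1 | x1] := eqVneq (1 - x) 0.
  rewrite x1; have [-> _] := plG; rewrite expr1 mulr0 mul0r big1 // => A _.
  by rewrite expr0n eqn0Ngt nb_boundary_gt0 // mulr0.
rewrite -ribbon_poly_boundary //; congr (_ * _); apply: eq_bigr => A _.
(* The exponent of z vanishes, so the ribbon graph polynomial reduces termwise to the Tutte
   polynomial. *)
have -> : (comps G A)%:Z - (nb_boundary G A)%:Z + null G A = 0.
  by rewrite plane_boundary //; ring.
by rewrite mulr1 subKr (_ : - (1 - x) = x - 1) //; ring.
Qed.
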